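(* Let $P$ be a rooted forest. For $u,w\in P^*$ with $|w|-|u|\ge 3$, the following are equivalent: (1) the open interval $(u,w)$ is disconnected; (2) $u$ and $w$ are the concatenations $u=(v_1,a,v_2)$ and $w=(v_1,a,a,v_2)$ for some letter $a\in P$ and some $v_1,v_2\in P^*$; (3) there exists an embedding $\eta$ of $u$ in $w$ such that, for some $i$, $\eta(i)=0$, $w(i-1)=w(i)$, and $w(j)=\eta(j)$ for all $j\neq i$; (4) under the position labeling, $(u,w)$ contains a minimal skipped interval with the maximal possible number of elements, i.e. with $|w|-|u|-1$ elements.
   Context: A rooted forest is a poset $P$ that is a disjoint union of trees, each rooted at a unique bottom element; equivalently, letting $P_0$ denote $P$ with a bottom element $0$ adjoined, every element of $P_0$ except $0$ covers exactly one element (each element $x$ of $P_0$ has finite rank, the length of the chain from $0$ to $x$). The order on $P_0$ is written $\le_0$. $P^*$ is the set of finite words over the alphabet $P$, with generalized subword order: $u\le w$ if there is a subword $w(i_1)w(i_2)\cdots w(i_k)$ ($i_1<\dots<i_k$) of the same length as $u$ with $u(j)\le_P w(i_j)$ for all $1\le j\le k$. $\ell(w)$ is the number of letters of $w$, and $|w|$ is the rank of $w$ in $P^*$, which equals the sum of the ranks of its letters in $P_0$. Intervals: $[u,w]=\{v: u\le v\le w\}$, $(u,w)=\{v: u<v<w\}$. The open interval $(u,w)$ is disconnected if its order complex (the simplicial complex of its chains) is disconnected, i.e. $(u,w)$ is the disjoint union of two nonempty subsets with no element of one comparable to an element of the other. For words $u,w$ over $P_0$, an embedding of $u$ in $w$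 is a word $\eta$ over $P_0$ obtained from $u$ by inserting $\ell(w)-\ell(u)$ zeros such that $\eta(i)\le_0 w(i)$ for $1\le i\le\ell(w)$. Position labeling. Let $C: w=x_0\to x_1\to\cdots\to x_n=u$ be a maximal chain of $[u,w]$ read from top to bottom ($x_{i}$ covers $x_{i+1}$). In a covering $v'\to v$ in $P^*$, either one letter of $v'$ is replaced by the element it covers in $P$ (when $\ell(v)=\ell(v')$), or one letter of $v'$ that is a minimal element $a$ of $P$ is deleted; in the latter case, if this $a$ lies in a maximal consecutive sequence of $a$'s in $v'$, deleting any of them gives the same $v$, and by convention one always deletes the leftmost $a$ of the sequence. Working down from $w$, this determines inductively an embedding of each $x_i$ in $w$ (deleted letters become $0$). The label of the edge $x_i\to x_{i+1}$ along $C$ is the position in $w$ (an element of $\{1,\dots,\ell(w)\}$) whose letter is decreased or deleted. Maximal chains of $[u,w]$ are totally ordered lexicographically by their sequences of labels read from top to bottom. Minimal skipped intervals. For a maximal chain $C$ of $[u,w]$ and elements $x>y$ of $C$, $C(x,y)$ denotes the set of elements of $C$ strictly between $x$ and $y$. A nonempty set $C(x,y)$ is a skipped interval of $C$ if $C\setminus C(x,y)\subseteq C'$ for some maximal chain $C'$ of $[u,w]$ that precedes $C$ in the order above; it is a minimal skipped interval (MSI) if it does not properly contain another skipped interval of $C$. That $(u,w)$ contains an MSI means that some maximal chain $C$ of $[u,w]$ has that MSI. *)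

(* Defs.v *)
From HB Require Import structures.
From mathcomp Require Export all_boot all_order.
From mathcomp Require Export boolp classical_sets cardinality.

Set Implicit Arguments.
Unset Strict Implicit.
Unset Printing Implicit Defensive.

Import Order.TTheory.
Local Open Scope classical_set_scope.
Local Open Scope order_scope.

Section PosetNotions.
Context {d : Order.disp_t} {T : porderType d}.
Implicit Types (x y : T) (A : set T).

Definition covers x y : Prop := y < x /\ forall z, ~ (y < z < x).

Definition open_interval x y : set T := [set z | x < z < y].

(* The order complex of A is disconnected. *)
Definition disconnected A : Prop :=
  exists X Y : set T,
    [/\ X !=set0, Y !=set0, X `|` Y = A, X `&` Y = set0
      & forall x y, X x -> Y y -> ~~ (x >=< y)].

End PosetNotions.

(* P_0: the poset P with a bottom element, None, adjoined. *)
Definition adjoin_bottom (P : Type) : Type := option P.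

HB.instance Definition _ (P : choiceType) := Choice.on (adjoin_bottom P).

Section AdjoinBottom.
Context {d : Order.disp_t} {P : porderType d}.

Definition le0 (x y : adjoin_bottom P) : bool :=
  match x, y with
  | None, _ => true
  | Some _, None => false
  | Some a, Some b => a <= b
  end.

Lemma le0_refl : reflexive le0.
Proof. by case=> [a|] /=. Qed.

Lemma le0_anti : antisymmetric le0.
Proof. by case=> [a|] [b|] //= /le_anti ->. Qed.

Lemma le0_trans : transitive le0.
Proof. by case=> [b|] [a|] [c|] //=; apply: le_trans. Qed.

End AdjoinBottom.

HB.instance Definition _ (d : Order.disp_t) (P : porderType d) :=
  Order.Le_isPOrder.Build d (adjoin_bottom P)
    (@le0_refl d P) (@le0_anti d P) (@le0_trans d P).

Section RootedForest.
Context {d : Order.disp_t} {P : porderType d}.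

(* c lists in increasing order the elements of P below x, i.e. [0, x] is the
   finite chain 0 < c_1 < ... < c_k = x of P_0, whose length is k. *)
Definition chain_to (x : P) (c : seq P) : Prop :=
  sorted <%O c /\ forall y : P, (y \in c) = (y <= x).

Definition rank (x : P) : nat := size (xget [::] (chain_to x)).

End RootedForest.

Definition rooted_forest {d : Order.disp_t} (P : porderType d) : Prop :=
  (forall x : adjoin_bottom P, x != None ->
     exists! y : adjoin_bottom P, covers x y)
  /\ (forall x : P, exists c : seq P, chain_to x c).

(* P^*: words under generalized subword order. *)
Definition word (P : Type) : Type := seq P.

HB.instance Definition _ (P : choiceType) := Choice.on (word P).

Section Words.
Context {d : Order.disp_t} {P : porderType d}.
Implicit Types u v w : word P.

(* all2 requires both arguments to have the same size. *)
Definition le_word u w : bool :=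
  [exists m : (size w).-tuple bool, all2 <=%O u (mask m w)].

Lemma le_wordP u w :
  reflect (exists2 s, subseq s w & all2 <=%O u s) (le_word u w).
Proof.
apply: (iffP existsP) => [[m um]|[s /subseqP[m sz_m ->] um]].
  by exists (mask m w) => //; apply: mask_subseq.
by exists (Tuple (introT eqP sz_m)).
Qed.

Lemma all2_le_refl : reflexive (all2 (<=%O : rel P)).
Proof. by elim=> //= a s ->; rewrite lexx. Qed.

Lemma all2_le_anti : antisymmetric (all2 (<=%O : rel P)).
Proof.
elim=> [|a s IHs] [|b t] //= /andP[/andP[ab st] /andP[ba ts]].
by rewrite (@le_anti _ _ a b) ?ab ?ba // (IHs t) ?st ?ts.
Qed.

Lemma all2_le_trans : transitive (all2 (<=%O : rel P)).
Proof.
elim=> [|b t IHt] [|a s] [|c r] //= /andP[ab st] /andP[bc tr].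
by rewrite (le_trans ab bc) (IHt _ _ st tr).
Qed.

Lemma all2_le_size u w : all2 <=%O u w -> size u = size w.
Proof. by rewrite all2E => /andP[/eqP]. Qed.

Lemma all2_le_mask m u w :
  all2 <=%O u w -> all2 <=%O (mask m u) (mask m w).
Proof.
elim: m u w => [|b m IHm] [|x u] [|y w] //= /andP[xy uw].
by case: b => /=; rewrite ?xy IHm.
Qed.

Lemma le_word_refl : reflexive le_word.
Proof. by move=> u; apply/le_wordP; exists u; rewrite ?all2_le_refl. Qed.

Lemma le_word_size u w : le_word u w -> (size u <= size w)%N.
Proof. by case/le_wordP=> s /size_subseq sw /all2_le_size ->. Qed.

Lemma le_word_anti : antisymmetric le_word.
Proof.
have aux u w : le_word u w -> size u = size w -> all2 <=%O u w.
  case/le_wordP=> s sw us szuw.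
  have /eqP <- // : s == w.
  by rewrite -(size_subseq_leqif sw).2 -szuw (all2_le_size us).
move=> u w /andP[uw wu].
have szuw : size u = size w by apply/eqP; rewrite eqn_leq !le_word_size.
by apply: all2_le_anti; rewrite !aux.
Qed.

Lemma le_word_trans : transitive le_word.
Proof.
move=> v u w /le_wordP[s /subseqP[m _ ->] us] /le_wordP[t tw vt].
apply/le_wordP; exists (mask m t).
  exact: subseq_trans (mask_subseq m t) tw.
exact: all2_le_trans us (all2_le_mask m vt).
Qed.

End Words.

HB.instance Definition _ (d : Order.disp_t) (P : porderType d) :=
  Order.Le_isPOrder.Build d (word P)
    (@le_word_refl d P) (@le_word_anti d P) (@le_word_trans d P).

Section PositionLabeling.
Context {d : Order.disp_t} {P : porderType d}.
Local Notation P0 := (adjoin_bottom P).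
Implicit Types (u v w : word P) (eta : seq P0) (C : seq (word P)).

Definition word_rank w : nat := (\sum_(a <- w) rank a)%N.

Definition word0 w : seq P0 := [seq Some a | a <- w].

(* eta is obtained by inserting zeros into u0, the letters of u0 sitting at
   the positions selected by m. *)
Definition zero_insertion (u0 eta : seq P0) : Prop :=
  exists m : bitseq,
    [/\ size m = size eta, mask m eta = u0
      & all (pred1 None) (mask (map negb m) eta)].

Definition embedding (u0 w0 eta : seq P0) : Prop :=
  zero_insertion u0 eta /\ all2 <=%O eta w0.

Definition strip0 eta : word P := pmap id eta.

(* One step down at position p of an embedding: the letter at p is replaced by
   the element it covers in P_0. If that element is 0, the letter x is deleted
   and must be the leftmost of its run of x's in the word strip0 eta. *)
Definition decrease eta (p : nat) eta' : Prop :=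
  exists (x : P) (y : P0),
    [/\ onth eta p = Some (Some x), covers (Some x : P0) y,
        eta' = set_nth None eta p y
      & y = None -> ohead (rev (strip0 (take p eta))) <> Some x].

(* s is the rest of a chain below a word whose embedding is eta, and ls is
   the sequence of its labels. *)
Fixpoint labels_from eta (s : seq (word P)) (ls : seq nat) : Prop :=
  match s, ls with
  | [::], [::] => True
  | x :: s', l :: ls' => exists eta',
      [/\ decrease eta l eta', strip0 eta' = x & labels_from eta' s' ls']
  | _, _ => False
  end.

(* Chains are listed from top to bottom. Positions, hence labels, are counted
   from 0. *)
Definition position_labels w C (ls : seq nat) : Prop :=
  labels_from (word0 w) (behead C) ls.

Definition maximal_chain u w C : Prop :=
  if C is x :: s then
    [/\ x = w, last x s = u & path (fun v' v => `[< covers v' v >]) x s]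
  else False.

Definition precedes w C' C : Prop :=
  exists ls' ls : seq nat,
    [/\ position_labels w C' ls', position_labels w C ls
      & (ls' : seqlexi nat) < ls].

Definition skipped_interval u w C (I : set (word P)) : Prop :=
  [/\ exists x y, [/\ x \in C, y \in C, y < x
                    & I = [set z | z \in C /\ y < z < x]],
      I !=set0
    & exists C', [/\ maximal_chain u w C', precedes w C' C
                   & [set z | z \in C] `\` I `<=` [set z | z \in C']]].

Definition minimal_skipped_interval u w C (I : set (word P)) : Prop :=
  skipped_interval u w C I /\
  forall J, skipped_interval u w C J -> J `<=` I -> J = I.

End PositionLabeling.

(* Main.v *)
Require Import Defs.
From mathcomp Require Import zify.

Set Implicit Arguments.
Unset Strict Implicit.
Unset Printing Implicit Defensive.

Import Order.TTheory.
Local Open Scope classical_set_scope.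

(** Say that [w] doubles a letter of [u] when [u = v1 a v2] and [w = v1 a a v2].
    The description by embeddings says the same thing letter by letter.  The
    substance is a cycle: a disconnected interval has a chain whose whole
    interior is a minimal skipped interval; such a chain forces [w] to double a
    letter of [u]; and doubling disconnects the interval.

    If [(u, w)] is the union of two mutually incomparable parts, the interior of
    each maximal chain lies in one part.  Let [C] be the later of the two chains
    that come lexicographically first in their respective parts.  The earlier of
    the two skips the whole interior of [C].  A chain that precedes [C] cannot
    lie in the part of [C], hence avoids the interior of [C]: no smaller interval
    is skipped ([disconnected_full_msi]).

    Conversely let [C], with elements [w = x_0 > ... > x_n = u], have its whole
    interior as a minimal skipped interval.  If from some [x_i] a position
    smaller than the next label of [C] can be decreased so that the result still
    lies above [x_j], then following this detour skips [C(x_i, x_j)]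
    ([skipped_of_detour]), so minimality gives [i = 0] and [j = n].
    A descent in the labels would allow such a detour of length two
    ([decrease_swap]), so the labels weakly increase.  Let [t] be the last label.
    Nothing to the right of [t] ever changes, so [x_(n-1) = A b B] and
    [u = A y B], where [b] sits at position [t] and covers [y] in [P_0].
    A chain that precedes [C] must start with a smaller label than [C] does,
    hence at a position before [t]; its second element is [A' d B] with [d] the
    letter of [w] at [t], and [u <= A' d B].  Were [A <= A'], then [x_(n-1)] would
    lie below [A' d B], a forbidden detour.  Comparing [A y] with [A' d] this
    leaves only [y = 0] and [A = A1 c] with [c <= d].  The leftmost rule for
    deletions gives [c <> b], and [b] and [c] are comparable because both lie
    below [d]; hence [b < c <= d], and some [x_i] carries [c] at
    position [t]: [x_i = A1 c c B].  Decreasing the first [c] instead of the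
    second is a detour from [x_i] to [u = A1 c B], so [i = 0] and
    [w = A1 c c B] ([doubled_letter_of_run]).

    Finally, if [w = v1 a a v2] put [p = v1 a] and [s = a v2], so that [w = p s]
    and [u = v1 s = p v2].  An element of the interval splits as [x y] with
    [x <= p] and [y <= s], and lying above [u] forces [x = p] or [y = s].  The
    words [x s] and the words [p y] form the two parts
    ([doubled_letter_disconnected]). *)

(** * Rooted forests *)

Section Forest.
Context {d : Order.disp_t} {P : porderType d}.
Context (forestP : rooted_forest P).
Local Notation P0 := (adjoin_bottom P).

Lemma lt_Some (a b : P) : ((Some a : P0) < Some b)%O = (a < b)%O.
Proof. by rewrite !lt_neqAle. Qed.

Definition rank0 (y : P0) : nat := if y is Some a then rank a else 0.

Lemma chain_to_uniq (x : P) c c' : chain_to x c -> chain_to x c' -> c = c'.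
Proof.
move=> [sc mc] [sc' mc']; apply: lt_sorted_eq => // y.
by rewrite mc mc'.
Qed.

Lemma rankE (x : P) c : chain_to x c -> rank x = size c.
Proof.
by move=> xc; congr size; apply: (@chain_to_uniq x) => //; apply: xgetPex; exists c.
Qed.

Lemma forest_comparable (a b x : P) : (a <= x)%O -> (b <= x)%O -> (a >=< b)%O.
Proof.
have [c [sc mc]] := forestP.2 x; rewrite -!mc.
have : sorted <=%O c by apply: sub_sorted sc => ? ? /ltW.
move=> sc' /(nthP a)[i ic <-] /(nthP a)[j jc <-].
have h := sorted_leq_nth le_trans lexx a sc'.
by case: (leqP i j) => [ij|/ltnW ji]; apply/orP; [left|right]; apply: h.
Qed.

Lemma covers_exists (x : P) : exists y : P0, covers (Some x : P0) y.
Proof. by have [//|y [cy _]] := forestP.1 (Some x); exists y. Qed.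

Lemma covers_uniq (x : P0) (y y' : P0) : covers x y -> covers x y' -> y = y'.
Proof.
case: x => [x|] cy cy'; last by case: cy; case: y.
by have [//|z [_ uz]] := forestP.1 (Some x); rewrite -(uz y) // -(uz y').
Qed.

(** Elements below a common one are comparable, so [y] is the largest element
    strictly below [x].  Hence a descent from [x] by coverings passes through every
    element below [x] that it does not stay above. *)
Lemma le_covered (x y z : P0) : covers x y -> (z < x)%O -> (z <= y)%O.
Proof.
case: z => [b|] [yx nyx] bx //; case: y yx nyx => [a|] yx nyx; last first.
  by case: (nyx (Some b)); rewrite bx.
have /orP[//|ab] : (b >=< a)%O.
  by case: x bx yx {nyx} => // x bx yx; apply: forest_comparable (ltW bx) (ltW yx).
have [-> //|ab'] := eqVneq a b; case: (nyx (Some b)); rewrite bx andbT.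
by rewrite lt_neqAle; apply/andP; split => //; apply: contraNN ab' => /eqP[->].
Qed.

(** The chain below [x] is the chain below [y] with [x] added on top. *)
Lemma rank0_covers (x y : P0) : covers x y -> rank0 x = (rank0 y).+1.
Proof.
move=> cxy; have [yx _] := cxy; case: x cxy yx => [x|]; last by case: y.
move=> cxy yx.
have [c [sc mc]] : exists c : seq P,
    sorted <%O c /\ forall z : P, (z \in c) = ((Some z : P0) <= y)%O.
  by case: (y) => [a|]; [apply: forestP.2 | exists [::]].
have -> : rank0 y = size c.
  case: y mc {cxy yx} => [a|] mc; first exact: rankE.
  by case: c sc mc => // z c' _ /(_ z); rewrite inE eqxx.
rewrite /= -(size_rcons c x); apply: rankE; split.
  case: (c) sc mc => // z c' sc mc; rewrite /= rcons_path; apply/andP; split => //.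
  have : last z c' \in z :: c' by apply: mem_last.
  by rewrite mc => le_y; rewrite -lt_Some; exact: (le_lt_trans le_y yx).
move=> z; rewrite mem_rcons inE mc; apply/orP/idP => [[/eqP-> //|zy]|].
  by apply: ltW; rewrite -lt_Some; apply: le_lt_trans zy yx.
rewrite le_eqVlt => /orP[->|zx]; first by left.
by right; apply: (@le_covered (Some x)) => //; rewrite lt_Some.
Qed.

Lemma le_rank (a b : P) : (a <= b)%O -> rank a <= rank b.
Proof.
move=> ab; have [[ca ha] [cb hb]] := (forestP.2 a, forestP.2 b).
rewrite (rankE ha) (rankE hb); apply: uniq_leq_size.
  by apply: (sorted_uniq lt_trans ltxx); case: ha.
by move=> z; rewrite ha.2 hb.2 => /le_trans; apply.
Qed.

End Forest.

(** * Generalized subword order *)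

Lemma all2_cat (S T : Type) (r : S -> T -> bool) (s1 s2 : seq S) (t1 t2 : seq T) :
  size s1 = size t1 -> all2 r (s1 ++ s2) (t1 ++ t2) = all2 r s1 t1 && all2 r s2 t2.
Proof. by elim: s1 t1 => [|x s1 IH] [|y t1] //= [/IH->]; rewrite andbA. Qed.

Section WordOrder.
Context {d : Order.disp_t} {P : porderType d}.
Implicit Types (u v w X Y S T : word P).

Lemma le_word_cat X Y S T : (X <= Y)%O -> (S <= T)%O -> (X ++ S <= Y ++ T :> word P)%O.
Proof.
move=> /le_wordP[s sY Xs] /le_wordP[t tT St]; apply/le_wordP; exists (s ++ t).
  exact: cat_subseq.
by rewrite all2_cat ?Xs ?(all2_le_size Xs).
Qed.

(** An embedding in a concatenation cuts the embedded word at the border.  All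
    comparisons of words below go through this. *)
Lemma le_word_split v X Y : (v <= X ++ Y :> word P)%O ->
  exists S T, [/\ v = S ++ T, (S <= X)%O & (T <= Y)%O].
Proof.
case/le_wordP=> s /subseqP[m sz_m ->] vs.
move: vs; rewrite -{1}(cat_take_drop (size X) m) mask_cat; last first.
  by rewrite size_takel // sz_m size_cat leq_addr.
set s1 := mask _ X; set s2 := mask _ Y => vs.
exists (take (size s1) v), (drop (size s1) v); rewrite cat_take_drop.
have sz_v := all2_le_size vs; rewrite size_cat in sz_v.
have : all2 <=%O (take (size s1) v ++ drop (size s1) v) (s1 ++ s2).
  by rewrite cat_take_drop.
rewrite all2_cat; last by rewrite size_takel ?sz_v ?leq_addr.
by case/andP=> ? ?; split=> //; apply/le_wordP; [exists s1|exists s2] => //;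
  apply: mask_subseq.
Qed.

Lemma le_word_catl X Y : (X <= X ++ Y :> word P)%O.
Proof. by apply/le_wordP; exists X; rewrite ?prefix_subseq ?all2_le_refl. Qed.

Lemma le_word_catr X Y : (Y <= X ++ Y :> word P)%O.
Proof. by apply/le_wordP; exists Y; rewrite ?suffix_subseq ?all2_le_refl. Qed.

Lemma size_le_word X Y : (X <= Y)%O -> size X <= size Y.
Proof. exact: le_word_size. Qed.

Lemma le_word1 (a b : P) : ([:: a] <= [:: b] :> word P)%O = (a <= b)%O.
Proof.
apply/idP/idP => [/le_wordP[s]|ab].
  case: s => [//|x [|y s]]; last by move=> _ /= /andP[].
  by rewrite sub1seq inE => /eqP-> /andP[].
by apply/le_wordP; exists [:: b] => //; apply/andP.
Qed.

Lemma cat_prefix X S X' S' : X ++ S = X' ++ S' -> size X <= size X' ->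
  exists2 R, X' = X ++ R & S = R ++ S'.
Proof.
elim: X X' => [|x X IH] [|x' X'] //= => [-> _|-> _|[-> /IH{}IH] /IH[R -> ->]].
- by exists [::].
- by exists (x' :: X').
- by exists R.
Qed.

(** [T] is too short to receive more than [S], so all of [X] is embedded in [Y]. *)
Lemma le_word_prefix X Y S T :
  (X ++ S <= Y ++ T :> word P)%O -> size T <= size S -> (X <= Y)%O.
Proof.
move=> /le_word_split[X' [S' [e leY leT]]] szTS.
have [|R eX' _] := cat_prefix e.
  have := congr1 size e; rewrite !size_cat; have := size_le_word leT; lia.
by apply: le_trans leY; rewrite eX'; apply: le_word_catl.
Qed.

Lemma le_word_suffix X Y S T :
  (X ++ S <= Y ++ T :> word P)%O -> size Y <= size X -> (S <= T)%O.
Proof.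
move=> /le_word_split[X' [S' [e leY leT]]] szYX.
have [|R _ eS'] := cat_prefix (esym e).
  have := congr1 size e; rewrite !size_cat; have := size_le_word leY; lia.
by apply: le_trans leT; rewrite eS'; apply: le_word_catr.
Qed.

Lemma le_rcons_inv X Y (y : P) : (X <= rcons Y y :> word P)%O ->
  (X <= Y)%O \/ exists X' c, [/\ X = rcons X' c, (X' <= Y)%O & (c <= y)%O].
Proof.
rewrite -cats1 => /le_word_split[S [T [-> leS]]].
case: T => [|c [|? ?]] leT; first by left; rewrite cats0.
  by right; exists S, c; rewrite cats1 -le_word1.
by have := size_le_word leT.
Qed.

End WordOrder.

(** * Coverings and decreases of embeddings *)

Section Embeddings.
Context {d : Order.disp_t} {P : porderType d}.
Context (forestP : rooted_forest P).
Local Notation P0 := (adjoin_bottom P).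
Implicit Types (u v w A B : word P) (e eta : seq P0).

Lemma strip0_cat e1 e2 : strip0 (e1 ++ e2) = strip0 e1 ++ strip0 e2.
Proof. exact: pmap_cat. Qed.

Lemma strip0_cons (y : P0) e : strip0 (y :: e) = seq_of_opt y ++ strip0 e.
Proof. by case: y. Qed.

Lemma strip0_word0 w : strip0 (word0 w) = w.
Proof. by rewrite /strip0; elim: w => //= x w ->. Qed.

Lemma le_seq_of_opt (y z : P0) : (y <= z)%O -> (seq_of_opt y <= seq_of_opt z :> word P)%O.
Proof.
case: y z => [a|] [b|] // ab; first by rewrite le_word1.
exact: (@le_word_catl _ _ [::]).
Qed.

Lemma strip0_split eta A x B : strip0 eta = A ++ x :: B ->
  exists E1 E2, [/\ eta = E1 ++ Some x :: E2, strip0 E1 = A & strip0 E2 = B].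
Proof.
elim: eta A => [[]//|[y|] eta IH] A /=.
  case: A => [|z A] /= [-> e]; first by exists [::], eta.
  by have [E1 [E2 [-> <- <-]]] := IH _ e; exists (Some z :: E1), E2.
by move=> /IH[E1 [E2 [-> <- <-]]]; exists (None :: E1), E2.
Qed.

(** [decrease] read on the two pieces around the affected position, which is the
    form that survives [strip0]. *)
Lemma decreaseP eta p eta' : decrease eta p eta' <->
  exists E1 x E2 y, [/\ eta = E1 ++ Some x :: E2, size E1 = p, eta' = E1 ++ y :: E2,
    covers (Some x : P0) y & y = None -> ohead (rev (strip0 E1)) <> Some x].
Proof.
split=> [[x [y [ex cxy -> run]]]|[E1 [x [E2 [y [-> <- -> cxy run]]]]]].
  have lt_p : p < size eta by rewrite -onthTE ex.
  exists (take p eta), x, (drop p.+1 eta), y; split=> //.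
  - by rewrite -{1}(cat_take_drop p eta) (drop_nth (None : P0)) // (onth_nth None _ _ _ ex).
  - by rewrite size_takel // ltnW.
  - by rewrite set_nthE lt_p.
exists x, y; split=> //.
- by rewrite onth_cat ltnn subnn.
- rewrite set_nthE size_cat /= addnS ltnS leq_addr take_size_cat //.
  by rewrite drop_cat ltnNge leqnSn /= subSnn /= drop0.
- by rewrite take_size_cat.
Qed.

Lemma word_rank_cat A B : word_rank (A ++ B) = word_rank A + word_rank B.
Proof. by rewrite /word_rank big_cat. Qed.

Lemma word_rank_opt (y : P0) : word_rank (seq_of_opt y) = rank0 y.
Proof. by case: y => [a|]; rewrite /word_rank /= (big_seq1, big_nil). Qed.

Lemma le_word_rank u w : (u <= w)%O -> word_rank u <= word_rank w.
Proof.
elim: w u => [|x w IH] u.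
  by move=> /size_le_word; case: u => // _; rewrite /word_rank big_nil.
rewrite -cat1s => /le_word_split[S [T [-> leS /IH leT]]].
rewrite !word_rank_cat leq_add // {leT IH}.
case: S leS => [|c [|? ?]] leS; last by have := size_le_word leS.
  by rewrite /word_rank big_nil.
by move: leS; rewrite le_word1 /word_rank !big_seq1; apply: le_rank.
Qed.

Lemma step_rank A x B (y : P0) : covers (Some x : P0) y ->
  word_rank (A ++ x :: B) = (word_rank (A ++ seq_of_opt y ++ B)).+1.
Proof.
move=> cxy; rewrite -(cat1s x B) !word_rank_cat word_rank_opt -[[:: x]]/(seq_of_opt (Some x : P0)).
by rewrite (word_rank_opt (Some x)) (rank0_covers forestP cxy); lia.
Qed.

Lemma step_lt A x B (y : P0) : covers (Some x : P0) y ->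
  (A ++ seq_of_opt y ++ B < A ++ x :: B :> word P)%O.
Proof.
move=> cxy; rewrite lt_neqAle; apply/andP; split.
  by apply/eqP => e; have := step_rank A B cxy; rewrite e; lia.
apply: le_word_cat => //; rewrite -[x :: B]cat1s; apply: le_word_cat => //.
by apply: (@le_seq_of_opt y (Some x)); apply: ltW; case: cxy.
Qed.

(** A word strictly below [w] either misses a letter of [w] or has a strictly
    smaller letter somewhere; lowering that letter of [w] by one step keeps it
    above.  So single steps are exactly the coverings. *)
Lemma lt_word_step v w : (v < w)%O -> exists A x B (y : P0),
  [/\ w = A ++ x :: B, covers (Some x : P0) y & (v <= A ++ seq_of_opt y ++ B :> word P)%O].
Proof.
elim: w v => [|x w IH] v.
  by move=> vw; have := size_le_word (ltW vw); case: v vw => //; rewrite ltxx.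
move=> vw; have := ltW vw; rewrite -cat1s => /le_word_split[S [T [ev leS leT]]].
have [y cxy] := covers_exists forestP x.
case: S leS ev => [|c [|? ?]] leS ev; last by have := size_le_word leS.
  exists [::], x, w, y; split => //; rewrite ev /=; apply: le_trans leT _.
  exact: le_word_catr.
move: leS; rewrite le_word1 le_eqVlt => /orP[/eqP ecx|cx]; last first.
  exists [::], x, w, y; split => //; rewrite ev.
  apply: (@le_word_cat _ _ [:: c] (seq_of_opt y)) => //.
  apply: (@le_seq_of_opt (Some c)); apply: (le_covered forestP cxy).
  by rewrite lt_Some.
have /IH[A [x' [B [y' [-> cxy' le']]]]] : (T < w)%O.
  rewrite lt_neqAle leT andbT; apply: contraTneq vw => eT.
  by rewrite ev eT ecx /= ltxx.
exists (x :: A), x', B, y'; split => //; rewrite ev ecx /=.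
exact: (@le_word_cat _ _ [:: x] [:: x]).
Qed.

Lemma lt_word_rank v w : (v < w)%O -> word_rank v < word_rank w.
Proof.
move=> /lt_word_step[A [x [B [y [-> cxy /le_word_rank]]]]].
by rewrite (step_rank A B cxy).
Qed.

Lemma step_covers A x B (y : P0) : covers (Some x : P0) y ->
  covers (A ++ x :: B : word P) (A ++ seq_of_opt y ++ B).
Proof.
move=> cxy; split=> [|z /andP[yz zx]]; first exact: step_lt.
have := lt_word_rank yz; have := lt_word_rank zx.
by rewrite (step_rank A B cxy); lia.
Qed.

Lemma covers_step w v : covers w v -> exists A x B (y : P0),
  [/\ w = A ++ x :: B, covers (Some x : P0) y & v = A ++ seq_of_opt y ++ B].
Proof.
move=> [/lt_word_step[A [x [B [y [-> cxy le]]]]] nvw].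
exists A, x, B, y; split=> //; apply/eqP; apply/negPn/negP => ne.
by case: (nvw (A ++ seq_of_opt y ++ B)); rewrite step_lt // lt_neqAle ne le.
Qed.

Lemma decrease_covers eta p eta' : decrease eta p eta' -> covers (strip0 eta) (strip0 eta').
Proof.
move=> /decreaseP[E1 [x [E2 [y [-> _ -> cxy _]]]]].
by rewrite !strip0_cat !strip0_cons; apply: step_covers.
Qed.

(** Every covering gets a label: a deletion that is not at the leftmost letter of
    its run is moved to the left until it is. *)
Lemma covers_decrease eta v : covers (strip0 eta) v ->
  exists p eta', decrease eta p eta' /\ strip0 eta' = v.
Proof.
move=> /covers_step[A [x [B [y [eA cxy ->]]]]].
have [n] := ubnP (size A); elim: n => // n IH in A B eA *; rewrite ltnS => szA.
have [[ey eAx]|good] := pselect (y = None /\ ohead (rev A) = Some x).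
  case/lastP: A eA szA eAx => // A z eA szA; rewrite rev_rcons => -[ez].
  have [||p [eta' [dec es]]] := IH A (x :: B).
  - by rewrite eA cat_rcons ez.
  - by move: szA; rewrite size_rcons.
  by exists p, eta'; split => //; rewrite es ey cat_rcons ez.
have [E1 [E2 [e1 e2 e3]]] := strip0_split eA.
exists (size E1), (E1 ++ y :: E2); split; last by rewrite strip0_cat strip0_cons e2 e3.
apply/decreaseP; exists E1, x, E2, y; split=> // ey; rewrite e2 => eAx.
exact: good.
Qed.

(** The label of a covering is determined.  If decreasing at [p1 < p2] gives the
    same word, both steps are deletions, and comparing the words around the two
    positions shows that the letter just before [p2] equals the one deleted at
    [p2], against the leftmost rule. *)
Lemma decrease_inj eta p1 p2 e1 e2 :
  decrease eta p1 e1 -> decrease eta p2 e2 -> strip0 e1 = strip0 e2 -> p1 = p2.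
Proof.
wlog: p1 p2 e1 e2 / p1 < p2 => [wl|lt12].
  case: (ltngtP p1 p2) => // lt12 d1 d2 es; last by apply/esym; apply: wl d2 d1 _.
  exact: wl d1 d2 es.
move=> /decreaseP[E1 [x1 [E2 [y1 [-> sz1 -> c1 run1]]]]].
move=> /decreaseP[F1 [x2 [F2 [y2 [eF sz2 -> c2 run2]]]]].
have [|R eF1 eE2] := cat_prefix eF; first by rewrite sz1 sz2 ltnW.
case: R eF1 eE2 => [|r R] eF1.
  by move: lt12; rewrite -sz1 -sz2 eF1 cats0 ltnn.
move=> [er eE2]; move: eF1; rewrite -{r}er => eF1.
move: run2; rewrite eF1 eE2 !(strip0_cat, strip0_cons) /= -!catA /= => run2 /eqP.
rewrite eqseq_cat // eqxx /= -cat_rcons -cats1 -!catA => /eqP e.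
suff: False by [].
case: y1 c1 {run1} e => [z|] [lt1 _] /=; case: y2 c2 run2 => [z'|] [lt2 _] run2.
- by move=> [ez]; rewrite ez ltxx in lt1.
- by move=> /(congr1 size); rewrite /= !size_cat /=; lia.
- by move=> /(congr1 size); rewrite /= !size_cat /=; lia.
rewrite /= -cat_cons -[x2 :: strip0 F2]cat1s catA => /eqP.
rewrite eqseq_cat ?size_cat ?addn1 // => /andP[/eqP e _].
by case: (run2 erefl); rewrite rev_cat -e rev_cat.
Qed.

Lemma decrease_fun eta p e1 e2 : decrease eta p e1 -> decrease eta p e2 -> e1 = e2.
Proof.
move=> [x [y [ex cxy -> _]]] [x' [y' [ex' cxy' -> _]]].
by move: ex' cxy'; rewrite ex => -[<-] /(covers_uniq forestP cxy) ->.
Qed.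

(** A descent of labels can be started with the smaller one: the leftmost rule at
    [q] only looks at letters before [q], which the step at [p] leaves alone.
    Only an inequality is claimed, since the following step at [p] may have to be
    relabeled. *)
Lemma decrease_swap eta p e1 q e2 : decrease eta p e1 -> decrease e1 q e2 -> q < p ->
  exists2 e', decrease eta q e' & (strip0 e2 <= strip0 e')%O.
Proof.
move=> /decreaseP[E1 [x1 [E2 [y1 [-> sz1 -> c1 run1]]]]].
move=> /decreaseP[F1 [x2 [F2 [y2 [eF sz2 -> c2 run2]]]]] ltqp.
have [|R eF1 eE2] := cat_prefix (esym eF); first by rewrite sz1 sz2 ltnW.
case: R eF1 eE2 => [|r R] eF1.
  by move: ltqp; rewrite -sz1 -sz2 eF1 cats0 ltnn.
move=> [er eF2]; move: eF1; rewrite -{r}er => eF1.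
exists (F1 ++ y2 :: (R ++ Some x1 :: E2)).
  by apply/decreaseP; exists F1, x2, (R ++ Some x1 :: E2), y2; split=> //; rewrite eF1 -catA.
rewrite eF2 !(strip0_cat, strip0_cons); do 3 apply: le_word_cat => //.
by apply: le_word_cat => //; apply: le_seq_of_opt; apply: ltW; case: c1.
Qed.

End Embeddings.

(** * Labeled saturated chains *)

Lemma mkseq_cons (T : Type) (f : nat -> T) n : mkseq f n.+1 = f 0 :: mkseq (f \o succn) n.
Proof. by rewrite /mkseq /= -[1]addn0 iotaDl -map_comp. Qed.

Section DecreasingSequence.
Context {d : Order.disp_t} {T : porderType d} (x : nat -> T) (n : nat).
Context (x_decr : forall i j, i < j <= n -> (x j < x i)%O).

Lemma decr_ltE i j : i <= n -> j <= n -> (x j < x i)%O = (i < j).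
Proof.
move=> le_in le_jn; case: (ltngtP i j) => [ij|ji|->].
- by rewrite x_decr ?ij ?ji ?le_jn ?le_in.
- by rewrite lt_gtF ?x_decr ?ji ?le_in.
- by rewrite ltxx.
Qed.

Lemma mem_chain z : reflect (exists2 k, k <= n & z = x k) (z \in mkseq x n.+1).
Proof.
apply: (iffP mapP) => [[k]|[k kn ->]]; last by exists k => //; rewrite mem_iota.
by rewrite mem_iota ltnS => kn ->; exists k.
Qed.

Lemma between_chain i j : i <= n -> j <= n ->
  [set z | z \in mkseq x n.+1 /\ (x j < z < x i)%O] = x @` [set k | i < k < j].
Proof.
move=> le_in le_jn; apply/seteqP; split=> [z [/mem_chain[k kn ->]]|z [k /andP[ik kj] <-]] /=.
  by rewrite !decr_ltE // andbC => kij; exists k.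
split; first by apply/mem_chain; exists k => //; lia.
by rewrite !decr_ltE ?ik ?kj //; lia.
Qed.

Lemma card_between_chain i j : i < j <= n ->
  ([set z | z \in mkseq x n.+1 /\ (x j < z < x i)%O] #= `I_(j - i - 1))%card.
Proof.
move=> /andP[ij jn]; rewrite between_chain //; last by lia.
have -> : [set k | i < k < j] = (fun k => i.+1 + k) @` `I_(j - i - 1).
  apply/seteqP; split=> [k /= /andP[ik kj]|_ [k /= kij <-]] /=; last by lia.
  by exists (k - i.+1); lia.
rewrite image_comp; apply: inj_card_eq => k m; rewrite !inE /= => ki mi exy.
case: (ltngtP k m) => // km.
  have := @decr_ltE (i.+1 + k) (i.+1 + m); rewrite exy ltxx ltn_add2l km => h.
  by have : false = true by apply: h; lia.
have := @decr_ltE (i.+1 + m) (i.+1 + k); rewrite exy ltxx ltn_add2l km => h.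
by have : false = true by apply: h; lia.
Qed.

End DecreasingSequence.

Section Runs.
Context {d : Order.disp_t} {P : porderType d}.
Context (forestP : rooted_forest P).
Local Notation P0 := (adjoin_bottom P).
Local Notation cov := (fun v' v : word P => `[< covers v' v >]).
Implicit Types (u v w : word P) (eta : seq P0) (e : nat -> seq P0) (l : nat -> nat).

(** A labeled saturated chain as a pair of functions: [e i] is the embedding in the
    top word after [i] steps and [l i] the label of the step that follows. *)
Definition run e l n := forall i, i < n -> decrease (e i) (l i) (e i.+1).

Lemma labels_from_run eta s ls : labels_from eta s ls ->
  exists e l, [/\ e 0 = eta, run e l (size s),
    s = mkseq (fun i => strip0 (e i.+1)) (size s) & ls = mkseq l (size s)].
Proof.
elim: s eta ls => [|x s IH] eta [|p ls] //=; first by exists (fun=> eta), (fun=> 0).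
move=> [eta' [dec ex /IH[e [l [e0 re es els]]]]].
exists (fun i => if i is k.+1 then e k else eta), (fun i => if i is k.+1 then l k else p).
split=> // [[|i] ilt||]; rewrite ?e0 //; first exact: re.
  by rewrite mkseq_cons /= e0 ex {1}es.
by rewrite mkseq_cons /= {1}els.
Qed.

Lemma run_labels_cat e l i s ls : run e l i -> labels_from (e i) s ls ->
  labels_from (e 0) (mkseq (fun k => strip0 (e k.+1)) i ++ s) (mkseq l i ++ ls).
Proof.
elim: i e l => [|i IH] e l re le //; rewrite !mkseq_cons; exists (e 1); split=> //.
  exact: re.
by apply: (IH (e \o succn) (l \o succn)) => // k ki; apply: re.
Qed.

Lemma labels_from_exist eta s : path cov (strip0 eta) s -> exists ls, labels_from eta s ls.
Proof.
elim: s eta => [|x s IH] eta /=; first by exists [::].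
move=> /andP[/asboolP cx ps]; have [p [eta' [dec ex]]] := covers_decrease forestP cx.
by rewrite -ex in ps; have [ls hls] := IH _ ps; exists (p :: ls), eta'.
Qed.

Lemma labels_from_fun eta s s' ls :
  labels_from eta s ls -> labels_from eta s' ls -> s = s'.
Proof.
elim: ls eta s s' => [|p ls IH] eta [|x s] [|x' s'] //= [e1 [dec1 <- h1]] [e2 [dec2 <- h2]].
move: h2; rewrite -(decrease_fun forestP dec1 dec2) => h2.
by rewrite (IH _ _ _ h1 h2).
Qed.

Lemma labels_from_inj eta s ls ls' :
  labels_from eta s ls -> labels_from eta s ls' -> ls = ls'.
Proof.
elim: s eta ls ls' => [|x s IH] eta [|p ls] [|p' ls'] //= [e1 [dec1 e1x h1]] [e2 [dec2 e2x h2]].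
have ep : p = p' by apply: decrease_inj dec1 dec2 _; rewrite e1x.
move: dec2 h2; rewrite -ep => dec2; rewrite -(decrease_fun forestP dec1 dec2) => h2.
by rewrite (IH _ _ _ h1 h2).
Qed.

Lemma saturated_chain v w : (v <= w)%O -> exists2 s, path cov w s & last w s = v.
Proof.
have [n] := ubnP (word_rank w); elim: n w => // n IH w; rewrite ltnS => rw.
rewrite le_eqVlt => /orP[/eqP->|]; first by exists [::].
move=> /(lt_word_step forestP)[A [x [B [y [ew cxy]]]]].
move: rw; rewrite ew (step_rank forestP A B cxy) => rw /IH[//|s ps ls].
exists ((A ++ seq_of_opt y ++ B) :: s) => //=; rewrite ps andbT; apply/asboolP.
exact: step_covers.
Qed.

Lemma maximal_chain_labels u w C : maximal_chain u w C -> exists ls, position_labels w C ls.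
Proof.
by case: C => // x s [-> _ ps]; apply: labels_from_exist; rewrite strip0_word0.
Qed.

Lemma run_path e l n : run e l n ->
  path cov (strip0 (e 0)) (mkseq (fun i => strip0 (e i.+1)) n).
Proof.
elim: n e l => [|n IH] e l re //; rewrite mkseq_cons /=; apply/andP; split.
  by apply/asboolP; apply: (decrease_covers forestP (re 0 _)).
by apply: (IH (e \o succn) (l \o succn)) => k ki; apply: re.
Qed.

Lemma run_rank e l n i : run e l n -> i <= n ->
  word_rank (strip0 (e i)) + i = word_rank (strip0 (e 0)).
Proof.
elim: i => [|i IH] re lin; first by rewrite addn0.
rewrite -IH //; last exact: ltnW.
have /decreaseP[E1 [x [E2 [y [-> _ -> cxy _]]]]] := re _ lin.
by rewrite !strip0_cat !strip0_cons (step_rank forestP _ _ cxy); lia.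
Qed.

Lemma run_decr e l n : run e l n ->
  forall i j, i < j <= n -> (strip0 (e j) < strip0 (e i))%O.
Proof.
move=> re i; elim=> // j IH /andP[]; rewrite ltnS leq_eqVlt => ij jn.
have lt1 : (strip0 (e j.+1) < strip0 (e j))%O by case: (decrease_covers forestP (re _ jn)).
case/orP: ij => [/eqP-> //|ij]; apply: lt_trans lt1 _; apply: IH; lia.
Qed.

Lemma maximal_chain_run u w C ls : maximal_chain u w C -> position_labels w C ls ->
  exists e l n, [/\ e 0 = word0 w, strip0 (e n) = u, run e l n,
    C = mkseq (strip0 \o e) n.+1 & ls = mkseq l n] /\ n = word_rank w - word_rank u.
Proof.
case: C => // x s [-> lasts ps] /(@labels_from_run _ s)[e [l [e0 re es els]]].
have eu : strip0 (e (size s)) = u.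
  rewrite -lasts; move: {+}es; case: (size s) => [|m] ->; first by rewrite e0 strip0_word0.
  by rewrite mkseqS last_rcons.
exists e, l, (size s); split; first split=> //.
  by rewrite mkseq_cons /= e0 strip0_word0 {1}es.
by have := run_rank re (leqnn _); rewrite eu e0 strip0_word0; lia.
Qed.

End Runs.

(** * Detours and skipped intervals *)

Section LetterwiseEffect.
Context {d : Order.disp_t} {P : porderType d}.
Local Notation P0 := (adjoin_bottom P).
Implicit Types (eta : seq P0).

Lemma decrease_take eta p eta' q : decrease eta p eta' -> q <= p -> take q eta' = take q eta.
Proof.
move=> /decreaseP[E1 [x [E2 [y [-> sz -> _ _]]]]] qp.
by rewrite !takel_cat ?sz.
Qed.

Lemma decrease_drop eta p eta' q : decrease eta p eta' -> p < q -> drop q eta' = drop q eta.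
Proof.
move=> /decreaseP[E1 [x [E2 [y [-> sz -> _ _]]]]] pq.
by rewrite !drop_cat sz ltnNge ltnW //=; move: pq; rewrite -subn_gt0; case: (q - p).
Qed.

Lemma decrease_nth_neq eta p eta' q : decrease eta p eta' -> q <> p ->
  nth None eta' q = nth None eta q.
Proof. by move=> [x [y [_ _ -> _]]] /eqP qp; rewrite nth_set_nth /= (negbTE qp). Qed.

Lemma decrease_nth_covers eta p eta' : decrease eta p eta' ->
  covers (nth None eta p : P0) (nth None eta' p).
Proof. by move=> [x [y [ex cxy -> _]]]; rewrite nth_set_nth /= eqxx (onth_nth None _ _ _ ex). Qed.

Lemma decrease_nth_le eta p eta' q : decrease eta p eta' ->
  ((nth None eta' q : P0) <= nth None eta q)%O.
Proof.
move=> dec; have [->|/eqP qp] := eqVneq q p; last by rewrite (decrease_nth_neq dec).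
by apply: ltW; case: (decrease_nth_covers dec).
Qed.

End LetterwiseEffect.

Lemma ltxi_cat (s r r' : seq nat) p q : p < q ->
  ((s ++ p :: r : seqlexi nat) < (s ++ q :: r' : seqlexi nat))%O.
Proof.
move=> pq; elim: s => [|x s IH] /=; last by rewrite eqhead_ltxiE.
by rewrite neqhead_ltxiE // neq_ltn pq.
Qed.

Section Skipping.
Context {d : Order.disp_t} {P : porderType d}.
Context (forestP : rooted_forest P).
Local Notation P0 := (adjoin_bottom P).
Local Notation cov := (fun v' v : word P => `[< covers v' v >]).
Implicit Types (u v w : word P) (eta : seq P0) (e : nat -> seq P0) (l : nat -> nat).

Definition chain_of e n : seq (word P) := mkseq (strip0 \o e) n.+1.

Definition chain_between e n i j : set (word P) :=
  [set z | z \in chain_of e n /\ (strip0 (e j) < z < strip0 (e i))%O].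

Lemma chain_of_mem e n k : k <= n -> strip0 (e k) \in chain_of e n.
Proof. by move=> kn; apply/mem_chain; exists k. Qed.

Lemma last_run e i : last (strip0 (e 0)) (mkseq (fun k => strip0 (e k.+1)) i) = strip0 (e i).
Proof. by case: i => // i; rewrite mkseqS last_rcons. Qed.

Lemma mkseqD (T : Type) (f : nat -> T) i k :
  mkseq f (i + k) = mkseq f i ++ mkseq (fun m => f (i + m)) k.
Proof.
elim: i f => [|i IH] f //; rewrite addSn !mkseq_cons IH.
by congr (_ :: _ ++ _); apply: eq_mkseq => m; rewrite /= addSn.
Qed.

Lemma run_maximal_chain e l n w : e 0 = word0 w -> run e l n ->
  maximal_chain (strip0 (e n)) w (chain_of e n) /\ position_labels w (chain_of e n) (mkseq l n).
Proof.
move=> e0 re; have ew : strip0 (e 0) = w by rewrite e0 strip0_word0.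
rewrite /chain_of mkseq_cons; split.
  split; [exact: ew | exact: last_run | exact: (run_path forestP re)].
rewrite /position_labels -e0 -(cats0 (mkseq l n)) -(cats0 (behead _)).
exact: run_labels_cat.
Qed.

Lemma chain_between_nonempty e l n i j : run e l n -> i.+1 < j <= n ->
  chain_between e n i j !=set0.
Proof.
move=> re ij; exists (strip0 (e i.+1)); split; first by apply: chain_of_mem; lia.
by rewrite !(run_decr forestP re) //; lia.
Qed.

Lemma skipped_outside e l n i j (C' : seq (word P)) : run e l n -> i <= n -> j <= n ->
  (forall k, k <= n -> (k <= i) || (j <= k) -> strip0 (e k) \in C') ->
  [set z | z \in chain_of e n] `\` chain_between e n i j `<=` [set z | z \in C'].
Proof.
move=> re le_in le_jn inC' z [/mem_chain[k kn ->] nb]; apply: inC' => //.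
apply/negPn/negP; rewrite negb_or -!ltnNge => /andP[ik kj]; apply: nb.
by split; [exact: chain_of_mem | rewrite !(run_decr forestP re) //=; lia].
Qed.

(** The chain that follows [C] down to [e i], takes the step at [p], descends to
    [e j] and then follows [C] again precedes [C] and contains all of [C] except
    possibly the elements strictly between [e i] and [e j]. *)
Lemma skipped_of_detour e l n w i j p eta : e 0 = word0 w -> run e l n ->
  i.+1 < j <= n -> decrease (e i) p eta -> p < l i -> (strip0 (e j) <= strip0 eta)%O ->
  skipped_interval (strip0 (e n)) w (chain_of e n) (chain_between e n i j).
Proof.
move=> e0 re ij dec pl le_j; have ew : strip0 (e 0) = w by rewrite e0 strip0_word0.
have [mC labC] := run_maximal_chain e0 re.
have [i_n j_n] : i < n /\ j <= n by lia.
split.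
- exists (strip0 (e i)), (strip0 (e j)); split=> //; try by apply: chain_of_mem; lia.
  by rewrite (run_decr forestP re) //; lia.
- exact: (chain_between_nonempty re).
have [D pD lD] := saturated_chain forestP le_j.
pose R := mkseq (fun m => strip0 (e (j + m).+1)) (n - j).
have eR : mkseq (fun k => strip0 (e k.+1)) n = mkseq (fun k => strip0 (e k.+1)) j ++ R.
  by rewrite -{1}(subnKC j_n) mkseqD.
have pR : path cov (strip0 (e j)) R.
  by have := run_path forestP re; rewrite eR cat_path last_run => /andP[].
have lR : last (strip0 (e j)) R = strip0 (e n).
  by rewrite -[RHS]last_run eR last_cat last_run.
pose s' := strip0 eta :: D ++ R.
have ps' : path cov (strip0 (e i)) s'.
  rewrite /= cat_path pD lD pR !andbT; apply/asboolP.
  exact: (decrease_covers forestP dec).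
have [lR' labR'] : exists ls, labels_from eta (D ++ R) ls.
  by apply: labels_from_exist => //; move: ps' => /andP[].
exists (w :: mkseq (fun k => strip0 (e k.+1)) i ++ s'); split.
- split=> //.
    by rewrite last_cat /= last_cat lD lR.
  rewrite cat_path -ew last_run ps' andbT; apply: (run_path forestP (l := l)) => k ki.
  by apply: re; lia.
- exists (mkseq l i ++ p :: lR'), (mkseq l n); split=> //.
    rewrite /position_labels -e0; apply: run_labels_cat; first by move=> k ki; apply: re; lia.
    by exists eta.
  rewrite -(subnKC i_n) mkseqD mkseqS cat_rcons; exact: ltxi_cat.
apply: (skipped_outside re) => [||k kn kij]; rewrite ?(ltnW i_n) //.
case: k kn kij => [|k] kn kij; first by rewrite ew inE eqxx.
rewrite inE mem_cat; apply/orP; right; case/orP: kij => [ki|].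
  by apply/orP; left; apply/mapP; exists k => //; rewrite mem_iota.
rewrite leq_eqVlt => /orP[/eqP jk|jk]; apply/orP; right; rewrite /s'.
  by rewrite -cat_cons mem_cat -jk -lD mem_last.
rewrite inE mem_cat; apply/orP; right; apply/orP; right.
by apply/mapP; exists (k - j); [rewrite mem_iota; lia | congr (strip0 (e _)); lia].
Qed.

End Skipping.

(** * Chains whose interior is a minimal skipped interval *)

Section Implications.
Context {d : Order.disp_t} {P : porderType d}.
Context (forestP : rooted_forest P).
Local Notation P0 := (adjoin_bottom P).
Implicit Types (u v w : word P) (eta : seq P0) (e : nat -> seq P0) (l : nat -> nat).

Definition doubled_letter u w := exists (a : P) (v1 v2 : word P),
  u = v1 ++ [:: a] ++ v2 /\ w = v1 ++ [:: a; a] ++ v2.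

Lemma first_failure (Q : pred nat) n : Q 0 -> ~~ Q n -> exists i, [/\ i < n, Q i & ~~ Q i.+1].
Proof.
elim: n => [->//|n IH] Q0 nQ; have [Qn|nQn] := boolP (Q n); first by exists n.
by have [i [ilt Qi nQi]] := IH Q0 nQn; exists i; split => //; apply: ltnW.
Qed.

(** The two hypotheses on the chain extract what minimality and skippedness of its
    interior mean: only the pair of endpoints bounds a skipped interval, and some
    word above the bottom is reached from the top by a smaller first label. *)
Lemma doubled_letter_of_run e l n w : e 0 = word0 w -> run e l n -> 2 < n ->
  (forall i j, i.+1 < j <= n ->
     skipped_interval (strip0 (e n)) w (chain_of e n) (chain_between e n i j) ->
     i = 0 /\ j = n) ->
  (exists p eta, [/\ p < l 0, decrease (word0 w) p eta & (strip0 (e n) <= strip0 eta)%O]) ->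
  doubled_letter (strip0 (e n)) w.
Proof.
move=> e0 re n3 full.
have key i j p eta : i.+1 < j <= n -> decrease (e i) p eta -> p < l i ->
    (strip0 (e j) <= strip0 eta)%O -> i = 0 /\ j = n.
  by move=> ij dec pl le; apply: full => //; apply: (skipped_of_detour forestP) dec pl le.
(* A descent would give a detour around a single element, but n > 2. *)
have mono1 i : i.+1 < n -> l i <= l i.+1.
  move=> lin; rewrite leqNgt; apply/negP => desc.
  have [eta dec le] := decrease_swap (re _ (ltnW lin)) (re _ lin) desc.
  by have [] := key i i.+2 _ _ _ dec desc le; lia.
have mono i k : i <= k -> k < n -> l i <= l k.
  elim: k => [|k IH]; first by rewrite leqn0 => /eqP->.
  rewrite leq_eqVlt => /orP[/eqP-> //|ik] kn.
  by apply: leq_trans (mono1 _ kn); apply: IH => //; apply: ltnW.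
case=> p0 [eta [p0l dec0 leu]].
case: n re n3 full key mono1 mono leu => // m re n3 full key _ mono leu.
(* Labels increase weakly, so t is the rightmost position ever touched. *)
pose t := l m.
have p0t : p0 < t by apply: leq_trans p0l _; apply: mono.
have /decreaseP[E1 [b [E2 [y [eEm szE1 eEn cby conv]]]]] := re m (ltnSn m).
have drop_e i : i <= m.+1 -> drop t.+1 (e i) = drop t.+1 (word0 w).
  elim: i => [|i IH] lei; first by rewrite e0.
  rewrite -IH; last exact: ltnW.
  by rewrite (decrease_drop (re _ lei)) // ltnS; apply: mono.
have eE2 : drop t.+1 (word0 w) = E2.
  by rewrite -(drop_e m) // eEm drop_cat szE1 ltnNge leqnSn /= subSnn /= drop0.
have nth_e i : i <= m.+1 -> ((nth None (e i) t : P0) <= nth None (word0 w) t)%O.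
  elim: i => [|i IH] lei; first by rewrite e0.
  by apply: le_trans (decrease_nth_le _ (re _ lei)) _; apply: IH; apply: ltnW.
have nth_m : nth None (e m) t = Some b by rewrite eEm nth_cat szE1 ltnn subnn.
have nth_n : nth None (e m.+1) t = y by rewrite eEn nth_cat szE1 ltnn subnn.
have := nth_e m (leqnSn m); rewrite nth_m; case ed: (nth None (word0 w) t) => [dt|//] le_bd.
have {}le_bd : (b <= dt)%O by [].
have eeta : eta = take t eta ++ Some dt :: E2.
  have nth_eta : nth None eta t = Some dt by rewrite (decrease_nth_neq dec0) //; lia.
  rewrite -{1}(cat_take_drop t eta) (drop_nth (None : P0)); last first.
    by rewrite ltnNge; apply/negP => /(nth_default None); rewrite nth_eta.
  by rewrite nth_eta (decrease_drop dec0) ?eE2 //; exact: ltnW.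
set A := strip0 E1 in conv; set B := strip0 E2; pose A' := strip0 (take t eta).
have seta : strip0 eta = A' ++ dt :: B by rewrite eeta strip0_cat strip0_cons.
have sm : strip0 (e m) = A ++ b :: B by rewrite eEm strip0_cat strip0_cons.
have sn : strip0 (e m.+1) = A ++ seq_of_opt y ++ B by rewrite eEn strip0_cat strip0_cons.
(* Otherwise eta is a detour from the top to the last element but one. *)
have nleA : ~ (A <= A')%O.
  move=> leA; have [] := key 0 m p0 eta.
  - by rewrite leqnSn andbT.
  - by rewrite e0.
  - exact: p0l.
  - rewrite sm seta; apply: le_word_cat => //.
    by apply: (@le_word_cat _ _ [:: b] [:: dt]); rewrite ?le_word1.
  - by lia.
move: leu; rewrite sn seta; case: y {eEn} cby conv nth_n sn => [c1|] cby conv nth_n sn leu.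
  by case: nleA; apply: le_word_prefix leu _.
move: leu; rewrite -cat_rcons => leu.
have [//|[A1 [c [eA leA1 le_cd]]]] := le_rcons_inv (le_word_prefix leu (leqnn _)).
(* The leftmost rule of the last step, which deletes b just after c. *)
have neq_cb : c <> b by move=> ecb; apply: (conv erefl); rewrite eA rev_rcons ecb.
have [y cy] := covers_exists forestP c.
case: y cy => [c'|] cc'; last first.
  have /orP[le_cb|le_bc] := forest_comparable forestP le_cd le_bd.
    have lt_cb : (c < b)%O by rewrite lt_neqAle le_cb andbT; apply/eqP.
    by case: cby => _ /(_ (Some c))[]; rewrite lt_Some lt_cb.
  have lt_bc : (b < c)%O by rewrite lt_neqAle le_bc andbT; apply/eqP => /esym.
  by case: cc' => _ /(_ (Some b))[]; rewrite lt_Some lt_bc.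
(* The letter at t descends from d >= c to 0, hence passes through c. *)
have [i [lin /= Qi nQi]] : exists i, [/\ i < m.+1, ((Some c : P0) <= nth None (e i) t)%O
    & ~~ ((Some c : P0) <= nth None (e i.+1) t)%O].
  apply: (first_failure (Q := fun i => ((Some c : P0) <= nth None (e i) t)%O)).
    by rewrite e0 ed.
  by rewrite nth_n.
have li : l i = t.
  by case: (eqVneq t (l i)) => // /eqP ne; case/negP: nQi; rewrite (decrease_nth_neq (re _ lin)).
have nth_i : nth None (e i) t = Some c.
  have := decrease_nth_covers (re _ lin); rewrite li => cov.
  move: Qi; rewrite le_eqVlt => /orP[/eqP<- //|/(le_covered forestP cov) le].
  by case/negP: nQi.
have take_i k : i <= k -> k <= m.+1 -> take t (e k) = take t (e i).
  elim: k => [|k IH]; first by rewrite leqn0 => /eqP->.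
  rewrite leq_eqVlt => /orP[/eqP-> //|ik] kn; rewrite -IH //; last exact: ltnW.
  by rewrite (decrease_take (re _ kn)) // -li; apply: mono.
have ei : e i = E1 ++ Some c :: E2.
  rewrite -(cat_take_drop t (e i)) (drop_nth (None : P0)); last first.
    by rewrite ltnNge; apply/negP => /(nth_default None); rewrite nth_i.
  rewrite nth_i drop_e; last exact: ltnW.
  by rewrite eE2 -(take_i m) // eEm take_cat szE1 ltnn subnn take0 cats0.
have [F1 [F2 [eF eF1 eF2]]] : exists F1 F2,
    [/\ E1 = F1 ++ Some c :: F2, strip0 F1 = A1 & strip0 F2 = [::]].
  by apply: strip0_split; rewrite -/A eA cats1.
(* In A1 c c B the first c can be lowered instead of the second one. *)
have i0 : i = 0.
  have [||||//] := key i m.+1 (size F1) (F1 ++ Some c' :: F2 ++ Some c :: E2).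
  - rewrite andbC leqnn /= ltn_neqAle lin andbT; apply/eqP => im.
    by move: nth_i; rewrite (_ : i = m) ?nth_m; [case=> /esym | lia].
  - by apply/decreaseP; exists F1, c, (F2 ++ Some c :: E2), (Some c'); rewrite ei eF -catA.
  - by rewrite li /t -szE1 eF size_cat /=; lia.
  rewrite sn eA cat_rcons strip0_cat strip0_cons strip0_cat strip0_cons eF1 eF2.
  by apply: le_word_cat => //=; apply: (@le_word_catr _ _ [:: c']).
exists c, A1, B; split; first by rewrite eA cat_rcons.
by rewrite -(strip0_word0 w) -e0 -i0 ei strip0_cat strip0_cons -/A eA cat_rcons.
Qed.

(** By cardinality the interval is the whole interior of the chain.  A preceding
    chain with the same first label would share the element below [w], and would
    then skip a proper part of the interior. *)
Lemma msi_doubled_letter u w C I : word_rank u + 3 <= word_rank w ->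
  maximal_chain u w C -> minimal_skipped_interval u w C I ->
  (I #= `I_(word_rank w - word_rank u - 1))%card -> doubled_letter u w.
Proof.
move=> rank_uw mC [[[x [y [xC yC yx eI]]]
  _ [C' [mC' [ls' [ls [lab' lab lt_ls]]] inC']]] minI] cardI.
have [e [l [n [[e0 en re eC els] En]]]] := maximal_chain_run forestP mC lab.
have [e' [l' [n' [[e0' en' re' eC' els'] En']]]] := maximal_chain_run forestP mC' lab'.
have nn' : n' = n by rewrite En' En.
rewrite {n'}nn' in en' re' eC' els' En'.
have n3 : 2 < n by lia.
rewrite -En in cardI.
have decr := run_decr forestP re.
have eI' i j : i < j <= n -> [set z | z \in C /\ (strip0 (e j) < z < strip0 (e i))%O] =
    chain_between e n i j by rewrite eC.
have card_ij i j : i < j <= n -> I = chain_between e n i j -> i = 0 /\ j = n.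
  move=> ij eIij; have := card_between_chain decr ij.
  rewrite -[X in (X #= _)%card]/(chain_between e n i j) -eIij card_eq_sym => h.
  have /card_eq_II := card_eq_trans h cardI; lia.
have [i0 [j0 [in0 jn0]]] : exists i j, [/\ i <= n, j <= n, x = strip0 (e i) & y = strip0 (e j)].
  move: xC yC; rewrite eC => /mem_chain[i ? ->] /mem_chain[j ? ->].
  by exists i, j.
move=> ex ey.
have ij0 : i0 < j0 by rewrite -(decr_ltE decr) // -ex -ey.
have [||i00 j0n] := card_ij i0 j0; first by rewrite ij0.
  by rewrite eI ex ey eC.
have eIn : I = chain_between e n 0 n by rewrite eI ex ey eC i00 j0n.
have full i j : i.+1 < j <= n ->
     skipped_interval (strip0 (e n)) w (chain_of e n) (chain_between e n i j) ->
     i = 0 /\ j = n.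
  move=> ij sk; apply: card_ij; first by lia.
  apply/esym; apply: minI; first by rewrite eC -en.
  rewrite eIn => z [zC /andP[z1 z2]]; split=> //; apply/andP; split.
    case: (ltnP j n) => [jn|nj]; last by rewrite (_ : n = j); [exact: z1 | lia].
    by apply: lt_trans z1; apply: decr; rewrite jn leqnn.
  case: (posnP i) => [<- //|i_gt0]; apply: lt_trans z2 _; apply: decr; lia.
rewrite -en; apply: (doubled_letter_of_run e0 re) => //.
have dec0 : decrease (word0 w) (l' 0) (e' 1) by rewrite -e0'; apply: re'; lia.
exists (l' 0), (e' 1); split=> //; last first.
  by rewrite en -en'; apply: ltW; apply: (run_decr forestP re'); lia.
have n0 : n = n.-1.+1 by lia.
move: (lt_ls); rewrite els els' n0 !mkseq_cons ltxi_cons => /andP[+ _].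
rewrite leEnat leq_eqVlt => /orP[/eqP el|//].
have e1 : e' 1 = e 1.
  by apply: decrease_fun dec0 _ => //; rewrite -e0 el; apply: re; lia.
suff sk : skipped_interval (strip0 (e n)) w (chain_of e n) (chain_between e n 1 n).
  by have := full 1 n; rewrite n3 leqnn => /(_ isT sk)[].
split.
- exists (strip0 (e 1)), (strip0 (e n)); split=> //; try by apply: chain_of_mem; lia.
  by apply: decr; lia.
- by apply: (chain_between_nonempty forestP re); lia.
exists C'; split; first by rewrite en.
  by exists ls', ls; rewrite -(eC : C = chain_of e n).
apply: (skipped_outside forestP re) => [||k kn]; rewrite ?leqnn //; first by lia.
rewrite eC' => k1n; have [->|->|->] : [\/ k = 0, k = 1 | k = n].
- by case: k k1n kn => [|[|k]] ? ?; [constructor 1|constructor 2|constructor 3]; lia.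
- by rewrite e0 -e0'; apply: chain_of_mem.
- by rewrite -e1; apply: chain_of_mem; lia.
by rewrite en -en'; apply: chain_of_mem.
Qed.

End Implications.

(** * Disconnected intervals *)

Lemma lex_min_exists n (S : set (seq nat)) : S !=set0 -> (forall ls, S ls -> size ls = n) ->
  exists2 ls, S ls & forall ls', S ls' -> ((ls : seqlexi nat) <= ls')%O.
Proof.
elim: n S => [|n IH] S [ls0 Sls0] szS.
  by exists ls0 => // ls' _; have /size0nil-> := szS _ Sls0.
have exh : exists h, `[< exists r, S (h :: r) >].
  case: ls0 Sls0 => [/szS//|h r] Sr; exists h; apply/asboolP; by exists r.
case: (ex_minnP exh) => h /asboolP hS hmin.
have [||r Sr rmin] := IH [set r | S (h :: r)]; first by case: hS => r; exists r.
  by move=> r /= /szS[].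
exists (h :: r) => // ls'; case: ls' => [/szS//|h' r'] Sr'.
rewrite lexi_cons leEnat hmin /=; last by apply/asboolP; exists r'.
apply/implyP => h'h; apply: rmin => /=; suff -> : h = h' by [].
by apply/eqP; rewrite eqn_leq h'h hmin //; apply/asboolP; exists r'.
Qed.

Section Disconnected.
Context {d : Order.disp_t} {P : porderType d}.
Context (forestP : rooted_forest P).
Local Notation P0 := (adjoin_bottom P).
Implicit Types (u v w : word P) (X Y Z : set (word P)).

Definition labels_through u w Z : set (seq nat) :=
  [set ls | exists C, [/\ maximal_chain u w C, position_labels w C ls & exists2 z, z \in C & Z z]].

Lemma labels_through_size u w Z ls : labels_through u w Z ls ->
  size ls = word_rank w - word_rank u.
Proof.
case=> C [mC lab _]; have [e [l [n [[_ _ _ _ ->] ->]]]] := maximal_chain_run forestP mC lab.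
by rewrite size_mkseq.
Qed.

Lemma labels_through_nonempty u w Z : Z !=set0 -> Z `<=` open_interval u w ->
  labels_through u w Z !=set0.
Proof.
move=> [z Zz] /(_ z Zz)/andP[uz zw].
have [s1 p1 l1] := saturated_chain forestP (ltW zw).
have [s2 p2 l2] := saturated_chain forestP (ltW uz).
have mC : maximal_chain u w (w :: s1 ++ s2).
  by split=> //; [rewrite last_cat l1 | rewrite cat_path p1 l1].
have [ls lab] := maximal_chain_labels forestP mC.
exists ls, (w :: s1 ++ s2); split=> //; exists z => //.
by rewrite -l1 -cat_cons mem_cat mem_last.
Qed.

Lemma maximal_chain_comparable u w C x y : maximal_chain u w C ->
  x \in C -> y \in C -> (x >=< y)%O.
Proof.
move=> mC; have [ls lab] := maximal_chain_labels forestP mC.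
have [e [l [n [[_ _ re -> _] _]]]] := maximal_chain_run forestP mC lab.
move=> /mem_chain[i lin ->] /mem_chain[j lej ->].
have decr := run_decr forestP re.
apply/orP; case: (ltngtP i j) => [ij|ji|-> //]; last by left.
  by right; apply: ltW; apply: decr; rewrite ij.
by left; apply: ltW; apply: decr; rewrite ji.
Qed.

Definition full_msi u w := exists C I,
  [/\ maximal_chain u w C, minimal_skipped_interval u w C I
    & (I #= `I_(word_rank w - word_rank u - 1))%card].

(** A chain that skips less than the whole interior of the chain labeled [lsY]
    contains an element of that interior, so it passes through [Y] and cannot
    precede the lexicographically first chain through [Y]. *)
Lemma full_msi_of_separation u w X Y lsX lsY : word_rank u + 3 <= word_rank w ->
  X `|` Y = open_interval u w -> (forall x y, X x -> Y y -> ~~ (x >=< y)%O) ->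
  labels_through u w X lsX -> labels_through u w Y lsY ->
  (forall ls, labels_through u w Y ls -> ((lsY : seqlexi nat) <= ls)%O) ->
  ((lsX : seqlexi nat) < lsY)%O -> full_msi u w.
Proof.
move=> rank_uw XY incomp [CX [mCX labX _]] [C [mC lab [y yC Yy]]] minY ltXY.
have inY z : z \in C -> (u < z < w)%O -> Y z.
  move=> zC; have : (X `|` Y) z <-> open_interval u w z by rewrite XY.
  move=> [_ h] /h[Xz|//]; have := incomp _ _ Xz Yy.
  by rewrite (maximal_chain_comparable mC zC yC).
have [e [l [n [[e0 en re eC els] En]]]] := maximal_chain_run forestP mC lab.
have ew : strip0 (e 0) = w by rewrite e0 strip0_word0.
have decr := run_decr forestP re.
have card := card_between_chain decr (i := 0) (j := n).
exists C, (chain_between e n 0 n); split=> //; last first.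
  by rewrite -En -[n in `I_n]subn0 subnAC; apply: card; rewrite leqnn andbT; lia.
have wuCX : w \in CX /\ u \in CX.
  by case: CX mCX {labX} => // x s [-> <- _]; rewrite mem_head mem_last.
have wuC : w \in C /\ u \in C.
  by case: C mC {lab yC inY eC} => // x s [-> <- _]; rewrite mem_head mem_last.
split; first split.
- exists w, u; split; try by case: wuC.
    by rewrite -ew -en; apply: decr; lia.
  by rewrite eC -ew -en.
- by apply: (chain_between_nonempty forestP re); lia.
- exists CX; split=> //; first by exists lsX, lsY.
  rewrite eC; apply: (skipped_outside forestP re) => // k kn.
  rewrite leqn0 => /orP[/eqP->|nk]; first by rewrite ew; case: wuCX.
  by rewrite (_ : k = n) ?en; [case: wuCX | lia].
move=> J [_ _ [C' [mC' [ls' [ls [lab' labC lt_ls]]] sub]]] JI.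
apply/seteqP; split=> // z Iz; have [zC /andP[uz zw]] := Iz.
apply: contrapT => nJ; have zC' : z \in C'.
  by apply: (sub z); split=> //=; rewrite eC.
have els' : ls = lsY by apply: labels_from_inj labC lab.
have : labels_through u w Y ls'.
  exists C'; split=> //; exists z => //; apply: inY; first by rewrite eC.
  by rewrite -en uz -ew.
by move=> /minY; rewrite -els' => /(lt_le_trans lt_ls); rewrite ltxx.
Qed.

Lemma disconnected_full_msi u w : word_rank u + 3 <= word_rank w ->
  disconnected (open_interval u w) -> full_msi u w.
Proof.
move=> rank_uw [X [Y [X0 Y0 XY XI incomp]]].
have [subX subY] : X `<=` open_interval u w /\ Y `<=` open_interval u w.
  by rewrite -XY; split=> z; [left|right].
have [lsX sX minX] := lex_min_exists (labels_through_nonempty X0 subX)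
  (@labels_through_size u w X).
have [lsY sY minY] := lex_min_exists (labels_through_nonempty Y0 subY)
  (@labels_through_size u w Y).
have := le_total (lsX : seqlexi nat) lsY.
have [eXY|neXY] := eqVneq (lsX : seqlexi nat) lsY.
  move: sX sY; rewrite eXY => -[C [mC lab [x xC Xx]]] [C' [mC' lab' [y yC Yy]]].
  have eC : C' = C.
    case: C C' {xC yC} mC mC' lab lab' => // c s [] // c' s' [-> _ _] [-> _ _] lab lab'.
    by congr (_ :: _); apply: labels_from_fun lab' lab.
  rewrite eC in yC; have := incomp _ _ Xx Yy.
  by rewrite (maximal_chain_comparable mC xC yC).
case/orP => leXY.
  apply: (full_msi_of_separation (X := X) (Y := Y)) sX sY minY _ => //.
  by rewrite lt_neqAle neXY.
apply: (full_msi_of_separation (X := Y) (Y := X)) sY sX minX _ => //.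
- by rewrite setUC.
- by move=> y x Yy Xx; rewrite comparable_sym incomp.
by rewrite lt_neqAle eq_sym neXY.
Qed.

(** Rank at least two provides [b] with [0 < b < a], and [v1 b a v2],
    [v1 a b v2] show that neither part is empty. *)
Lemma doubled_letter_disconnected (a : P) (v1 v2 : word P) : 1 < rank a ->
  disconnected (open_interval (v1 ++ [:: a] ++ v2 : word P) (v1 ++ [:: a; a] ++ v2)).
Proof.
move=> rank_a; set u : word P := v1 ++ _; set w : word P := v1 ++ _.
pose p : word P := rcons v1 a; pose s : word P := a :: v2.
have eu1 : u = v1 ++ s by [].
have eu2 : u = p ++ v2 by rewrite /p cat_rcons.
have ew : w = p ++ s by rewrite /p cat_rcons.
have le_p (x : word P) : (rcons x a <= p :> word P)%O -> (x <= v1)%O.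
  by rewrite /p -!cats1 => h; apply: le_word_prefix h _.
have le_s (y : word P) : (a :: y <= s :> word P)%O -> (y <= v2)%O.
  by move=> h; apply: (@le_word_suffix _ _ [:: a] [:: a]) h _.
have le_xs (x : word P) : (x <= v1)%O -> (x ++ s <= u :> word P)%O.
  by rewrite eu1 => h; apply: le_word_cat.
have le_py (y : word P) : (y <= v2)%O -> (p ++ y <= u :> word P)%O.
  by rewrite eu2 => h; apply: le_word_cat.
have [y cy] := covers_exists forestP a; case: y cy => [b|] cab; last first.
  by move: rank_a; have := rank0_covers forestP cab; rewrite /= => ->.
pose X := [set v | (u < v < w)%O /\ exists2 x : word P, (x <= p)%O & v = x ++ s].
pose Y := [set v | (u < v < w)%O /\ exists2 y : word P, (y <= s)%O & v = p ++ y].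
(* u <= x y cuts u before or after its letter a: the right piece contains s,
   or the left one contains p. *)
have inXY v : (u < v < w)%O -> X v \/ Y v.
  move=> uvw; have /andP[uv vw] := uvw; move: (ltW vw).
  rewrite ew => /le_word_split[x [y [ev xp ys]]].
  move: (ltW uv); rewrite ev => /le_word_split[u1 [u2 [eu' u1x u2y]]].
  case: (leqP (size u1) (size v1)) => sz.
    left; split; [by rewrite -ev | exists x => //; congr (_ ++ _)].
    have [R _ eR] := cat_prefix (esym (etrans (esym eu1) eu')) sz.
    apply: (@le_anti _ (word P)); rewrite ys; apply: le_trans u2y; rewrite eR; exact: le_word_catr.
  right; split; [by rewrite -ev | exists y => //; congr (_ ++ _)].
  have [|R eR _] := cat_prefix (etrans (esym eu2) eu'); first by rewrite size_rcons.
  apply: (@le_anti _ (word P)); rewrite xp; apply: le_trans u1x; rewrite eR; exact: le_word_catl.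
have nXY x y : X x -> Y y -> (x >=< y)%O -> False.
  move=> [/andP[ux xw] [x0 x0p ex]] [/andP[uy yw] [y0 y0s ey]] /orP[].
    rewrite ex ey => /le_word_split[t1 [t2 [et t1p t2y]]].
    case: (leqP (size t1) (size x0)) => sz.
      have [R _ eR] := cat_prefix (esym et) sz.
      have : (s <= y0)%O by apply: le_trans t2y; rewrite eR; apply: le_word_catr.
      move=> sy; have ys : y0 = s by apply: (@le_anti _ (word P)); rewrite y0s.
      by move: yw; rewrite ey ys ew ltxx.
    have et' : rcons x0 a ++ v2 = t1 ++ t2 by rewrite -et cat_rcons.
    have [|R eR _] := cat_prefix et'; first by rewrite size_rcons.
    have : (rcons x0 a <= p :> word P)%O by apply: le_trans t1p; rewrite eR; apply: le_word_catl.
    move=> /le_p/le_xs; rewrite -ex => xu.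
    by move: (lt_le_trans ux xu); rewrite ltxx.
  rewrite ex ey => /le_word_split[t1 [t2 [et t1x t2s]]].
  case: (leqP (size p) (size t1)) => sz.
    have [R eR _] := cat_prefix et sz.
    have : (p <= x0)%O by apply: le_trans t1x; rewrite eR; apply: le_word_catl.
    move=> px; have xp : x0 = p by apply: (@le_anti _ (word P)); rewrite x0p.
    by move: xw; rewrite ex xp ew ltxx.
  have et' : t1 ++ t2 = v1 ++ (a :: y0) by rewrite -et /p cat_rcons.
  have [|R _ eR] := cat_prefix et'; first by move: sz; rewrite size_rcons ltnS.
  have : (a :: y0 <= s :> word P)%O by apply: le_trans t2s; rewrite eR; apply: le_word_catr.
  move=> /le_s/le_py; rewrite -ey => yu.
  by move: (lt_le_trans uy yu); rewrite ltxx.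
exists X, Y; split.
- exists (v1 ++ b :: s); split; last first.
    exists (rcons v1 b); last by rewrite cat_rcons.
    rewrite /p -!cats1; apply: le_word_cat => //; rewrite le_word1.
    by apply: ltW; rewrite -lt_Some; case: cab.
  apply/andP; split; last exact: (step_lt forestP v1 s cab).
  rewrite lt_neqAle; apply/andP; split.
    by apply/eqP => /(congr1 size); rewrite /u !size_cat /=; lia.
  by rewrite eu1; apply: le_word_cat => //; apply: (@le_word_catr _ _ [:: b]).
- exists (p ++ b :: v2); split; last first.
    exists (b :: v2) => //; apply: (@le_word_cat _ _ [:: b] [:: a]) => //; rewrite le_word1.
    by apply: ltW; rewrite -lt_Some; case: cab.
  apply/andP; split; last by rewrite ew; exact: (step_lt forestP p v2 cab).
  rewrite lt_neqAle; apply/andP; split.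
    by apply/eqP => /(congr1 size); rewrite /u !size_cat size_rcons /=; lia.
  by rewrite eu2; apply: le_word_cat => //; apply: (@le_word_catr _ _ [:: b]).
- apply/seteqP; split=> [v [[]|[]] //|v]; exact: inXY.
- apply: (@seteqP _ (X `&` Y) set0).2; split=> // v [Xv Yv].
  by have := nXY v v Xv Yv (comparablexx v).
by move=> x y Xx Yy; apply/negP; apply: nXY.
Qed.

(** * Doubled letters in terms of embeddings *)

Definition doubled_embedding u w := exists eta : seq P0,
         embedding (word0 u) (word0 w) eta /\
         exists i : nat,
           [/\ (0 < i < size w),
               nth None eta i = None,
               nth None (word0 w) i.-1 = nth None (word0 w) i
             & forall j : nat, (j < size w) -> j <> i ->
                 nth None (word0 w) j = nth None eta j].

Lemma zero_insertion_strip0 (u : word P) (eta : seq P0) :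
  zero_insertion (word0 u) eta -> strip0 eta = u.
Proof.
move=> [m [sz em alln]]; rewrite -[RHS]strip0_word0 -em {em}.
elim: m eta sz alln => [|[] m IH] [|y eta] // [sz] alln; rewrite [mask _ _]/=.
  by rewrite !strip0_cons IH.
by move: alln => /andP[/eqP-> alln]; rewrite strip0_cons IH.
Qed.

Lemma doubled_letter_embedding u w : doubled_letter u w -> doubled_embedding u w.
Proof.
move=> [a [v1 [v2 [-> ->]]]].
exists (word0 v1 ++ Some a :: None :: word0 v2); split.
  split.
    exists (nseq (size v1) true ++ true :: false :: nseq (size v2) true).
    rewrite !size_cat /= !size_nseq !size_map; split=> //.
    - rewrite mask_cat ?size_nseq ?size_map // /= !mask_true ?size_map //.
      by rewrite /word0 map_cat.
    - by rewrite map_cat mask_cat ?size_map ?size_nseq //= !map_nseq /= !mask_false.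
  rewrite /word0 map_cat all2_cat // !all2_le_refl /=.
  by rewrite lexx all2_le_refl.
have szv : size (word0 v1) = size v1 by rewrite size_map.
exists (size v1).+1; rewrite /word0 !map_cat /= -!/(word0 _); split.
- by rewrite size_cat /=; lia.
- by rewrite nth_cat szv ltnNge leqnSn subSnn.
- by rewrite !nth_cat szv ltnn ltnNge leqnSn subnn subSnn.
move=> j _ jv; rewrite !nth_cat; case: ltnP => // le_j.
case: (j - size (word0 v1)) (subnKC le_j) => [|[|k]] //=; rewrite szv => ej.
by case: jv; lia.
Qed.

Lemma doubled_embedding_letter u w : doubled_embedding u w -> doubled_letter u w.
Proof.
move=> [eta [[/zero_insertion_strip0 <- le] [i [/andP[i0 iw] ni eqi oth]]]].
have sz : size eta = size w by rewrite (all2_le_size le) size_map.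
have szw : size (word0 w) = size w by rewrite size_map.
have split_w : word0 w = take i.-1 (word0 w) ++ nth None (word0 w) i.-1 ::
    nth None (word0 w) i.-1 :: drop i.+1 (word0 w).
  rewrite -{1}(cat_take_drop i.-1 (word0 w)) (drop_nth (None : P0)) ?szw; last by lia.
  by rewrite prednK // (drop_nth (None : P0)) ?szw // -eqi.
have split_eta : eta = take i.-1 (word0 w) ++ nth None (word0 w) i.-1 ::
    None :: drop i.+1 (word0 w).
  apply: (@eq_from_nth _ (None : P0)); first by rewrite sz -szw {1}split_w !size_cat.
  move=> j; rewrite sz => jw; have [->|/eqP ji] := eqVneq j i.
    rewrite ni nth_cat size_takel ?szw; last by lia.
    have -> : (i < i.-1) = false by lia.
    by have -> : i - i.-1 = 1 by lia.
  rewrite -oth // {1}split_w !nth_cat; case: ifP => //.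
  rewrite size_takel ?szw; last by lia.
  by move=> lej; case ej : (j - i.-1) => [|[|k]] //; lia.
case ea : (nth None (word0 w) i.-1) => [a|]; last first.
  have : None \in word0 w by rewrite -ea mem_nth // szw; lia.
  by move=> /mapP[].
exists a, (take i.-1 w), (drop i.+1 w); split.
  by rewrite split_eta ea strip0_cat strip0_cons strip0_cons -map_take -map_drop !strip0_word0.
by rewrite -[LHS]strip0_word0 split_w ea strip0_cat !strip0_cons -map_take -map_drop !strip0_word0.
Qed.

End Disconnected.

Theorem theorem7p3 (d : Order.disp_t) (P : porderType d)
    (forestP : rooted_forest P) (u w : word P)
    (rank_uw : (word_rank u + 3 <= word_rank w)%N) :
  [<-> (* 1 *) disconnected (open_interval u w);
       (* 2 *) exists (a : P) (v1 v2 : word P),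
         u = v1 ++ [:: a] ++ v2 /\ w = v1 ++ [:: a; a] ++ v2;
       (* 3 *) exists eta : seq (adjoin_bottom P),
         embedding (word0 u) (word0 w) eta /\
         exists i : nat,
           [/\ (0 < i < size w)%N,
               nth None eta i = None,
               nth None (word0 w) i.-1 = nth None (word0 w) i
             & forall j : nat, (j < size w)%N -> j <> i ->
                 nth None (word0 w) j = nth None eta j];
       (* 4 *) exists (C : seq (word P)) (I : set (word P)),
         [/\ maximal_chain u w C,
             minimal_skipped_interval u w C I
           & (I #= `I_(word_rank w - word_rank u - 1))%card]].
Proof.
have msi2 : full_msi u w -> doubled_letter u w.
  by move=> [C [I [mC mI cI]]]; apply: msi_doubled_letter mC mI cI.
have dis2 : doubled_letter u w -> disconnected (open_interval u w).
  move=> [a [v1 [v2 [eu ew]]]]; rewrite eu ew; apply: doubled_letter_disconnected => //.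
  move: rank_uw; rewrite eu ew !word_rank_cat /word_rank !big_cons !big_nil; lia.
tfae.
- by move=> /(disconnected_full_msi forestP rank_uw)/msi2.
- exact: doubled_letter_embedding.
- by move=> /doubled_embedding_letter/dis2/(disconnected_full_msi forestP rank_uw).
by move=> /msi2/dis2.
Qed.
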